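(* Let $X$ be a separable Banach space and assume that $X^*$ has property $( * )$. Then $\ell_\infty^n$ is in the $n$-th weak$^*$ asymptotic structure of $X^*$ for every $n\ge1$.
   Context: Let $T_n=\{\emptyset\}\cup\bigcup_{k=1}^n\mathbb N^k$; $|s|$ is the length of $s$, and $s_{|i}$ its initial segment of length $i$. For $t=(t_1,\dots,t_m)$ and $k\in\mathbb N$, $(t,k)$ denotes the sequence $(t_1,\dots,t_m,k)$ obtained by appending $k$ to $t$ (so $(\emptyset,k)=(k)$). A family $(x_s^* )_{s\in T_n}\subset X^*$ is weak$^*$-null if $w^*\text{-}\lim_k x^*_{(t,k)}=0$ for every $t\in T_{n-1}$ (where $T_0=\{\emptyset\}$). Let $B_{X^*}$ be the closed unit ball of $X^*$. Property $( * )$: there is $\varepsilon>0$ such that for all $n\ge1$ there is a weak$^*$-null family $(x_s^* )_{s\in T_n}\subset X^*$ with $x_\emptyset^*\in B_{X^*}$, $\|x_s^*\|\ge\varepsilon$ for all $s\ne\emptyset$, and $x_\emptyset^*+\sum_{i=1}^n\varepsilon_ix^*_{s_{|i}}\in B_{X^*}$ for all $s\in T_n$ with $|s|=n$ and all $\varepsilon_1,\dots,\varepsilon_n\in\{-1,1\}$. Let $\mathrm{cof}_{w^*}(X^* )$ be the set of weak$^*$-closed subspaces of $X^*$ of finite codimension; $S_Y$ denotes the unit sphere of $Y$. An $n$-dimensional space $E$ with normalized basis $(e_i)_{i=1}^n$ is in the $n$-th weak$^*$ asymptotic structure of $X^*$ if for all $\varepsilon>0$: $\forall X_1\in\mathrm{cof}_{w^*}(X^*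 )\ \exists x_1^*\in S_{X_1}\ \cdots\ \forall X_n\in\mathrm{cof}_{w^*}(X^* )\ \exists x_n^*\in S_{X_n}$: $(x_i^* )_{i=1}^n$ is $(1+\varepsilon)$-equivalent to $(e_i)_{i=1}^n$. Here $(x_i)$ is $C$-equivalent to $(e_i)$ if there are $A,B>0$ with $AB\le C$ and $\frac1A\|\sum a_ie_i\|\le\|\sum a_ix_i\|\le B\|\sum a_ie_i\|$ for all scalars $a_i$. $\ell_\infty^n$ is taken with its unit vector basis. *)

(* Defs.v *)
From HB Require Import structures.
From mathcomp Require Import all_boot all_order all_algebra.
From mathcomp Require Import all_classical all_reals all_analysis.

Set Implicit Arguments.
Unset Strict Implicit.
Unset Printing Implicit Defensive.

Import Order.TTheory GRing.Theory Num.Theory.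
Import numFieldNormedType.Exports.

Local Open Scope classical_set_scope.
Local Open Scope ring_scope.

Definition separable (T : topologicalType) : Prop :=
  exists2 D : set T, countable D & dense D.

Section Dual.
Context {R : realType} (X : normedModType R).

Definition continuous_linear_form : {pred X -> R^o} :=
  fun f => `[< linear f /\ continuous f >].

Record dual := Dual {
  dual_fun :> X -> R^o;
  _ : dual_fun \in continuous_linear_form }.

HB.instance Definition _ := [isSub for dual_fun].
HB.instance Definition _ := [Choice of dual by <:].

Lemma dual_linear (f : dual) : linear f.
Proof. by case: f => f /= /asboolP[]. Qed.

Lemma dual_continuous (f : dual) : continuous f.
Proof. by case: f => f /= /asboolP[]. Qed.

Lemma continuous_linear_form_submod : submod_closed continuous_linear_form.
Proof.
split=> [|a f g /asboolP[lf cf] /asboolP[lg cg]]; apply/asboolP.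
  split=> [b u v|]; last exact: cst_continuous.
  by rewrite /= -[0 u]/(0 : R) scaler0 addr0.
split=> [b u v|x].
  rewrite -![(_ + _ : X -> R^o) _]/(_ + _) -![(_ *: f) _]/(_ *: f _) lf lg.
  by rewrite !scalerDr !scalerA mulrC addrACA.
by apply: continuousD; [apply: continuousZl_tmp; exact: cf|exact: cg].
Qed.

HB.instance Definition _ := GRing.isSubmodClosed.Build _ _
  continuous_linear_form continuous_linear_form_submod.
HB.instance Definition _ := [SubChoice_isSubLmodule of dual by <:].

Definition dual_norm (f : dual) : R :=
  sup [set `|f x| | x in [set x : X | `|x| <= 1]].

Lemma dual_norm_has_ubound (f : dual) :
  has_ubound [set `|f x| | x in [set x : X | `|x| <= 1]].
Proof.
pose lf : {linear X -> R^o} :=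
  HB.pack (f : X -> R^o) (GRing.isLinear.Build _ _ _ _ _ (dual_linear f)).
have bf : bounded_near lf (nbhs (0 : X)).
  by apply: (@continuous_linear_bounded _ _ _ 0); exact: dual_continuous.
have [M fM] := (bounded_funP lf).2 bf 1.
by exists M => _ [x /= x1 <-]; exact: fM.
Qed.

Lemma dual_norm_ub (f : dual) (x : X) : `|x| <= 1 -> `|f x| <= dual_norm f.
Proof.
by move=> x1; apply: ub_le_sup; [exact: dual_norm_has_ubound|exists x].
Qed.

Lemma dual_norm_le (f : dual) (M : R) :
  (forall x, `|x| <= 1 -> `|f x| <= M) -> dual_norm f <= M.
Proof.
move=> fM; apply: ge_sup; last by move=> _ [x /= x1 <-]; exact: fM.
by exists `|f 0|, 0; rewrite //= normr0.
Qed.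

Lemma dual_norm_ge0 (f : dual) : 0 <= dual_norm f.
Proof.
by apply: le_trans (normr_ge0 (f 0)) _; apply: dual_norm_ub; rewrite normr0.
Qed.

Lemma dual_normD (f g : dual) :
  dual_norm (f + g) <= dual_norm f + dual_norm g.
Proof.
apply: dual_norm_le => x x1; rewrite (le_trans (ler_normD (f x) (g x)))//.
by rewrite lerD// dual_norm_ub.
Qed.

Lemma dual_normZ (a : R) (f : dual) :
  dual_norm (a *: f) = `|a| * dual_norm f.
Proof.
have le b g : dual_norm (b *: g) <= `|b| * dual_norm g.
  apply: dual_norm_le => x x1.
  by rewrite [leLHS](normrM b (g x)) ler_wpM2l// dual_norm_ub.
apply/eqP; rewrite eq_le le/=; have [->|a0] := eqVneq a 0.
  by rewrite normr0 mul0r dual_norm_ge0.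
rewrite -ler_pdivlMl ?normr_gt0// -normfV.
by rewrite -{1}[f](scalerK a0) le.
Qed.

Lemma dual_norm_eq0 (f : dual) : dual_norm f = 0 -> f = 0.
Proof.
move=> f0; apply: val_inj; apply: funext => x /=.
have [->|x0] := eqVneq x 0.
  by have := dual_linear f (-1) 0 0; rewrite scaleN1r addNr scaleN1r addNr.
have : `|f (`|x|^-1 *: x)| <= 0.
  by rewrite -f0 dual_norm_ub// normrZ normfV normr_id mulVf ?normr_eq0.
have f00 : f 0 = 0.
  by have := dual_linear f (-1) 0 0; rewrite scaleN1r addNr scaleN1r addNr.
rewrite normr_le0 -[_ *: x]addr0 dual_linear f00 addr0 scaler_eq0.
by rewrite invr_eq0 normr_eq0 (negPf x0) => /eqP.
Qed.

HB.instance Definition _ :=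
  Lmodule_isNormed.Build R dual dual_normD dual_normZ dual_norm_eq0.

(* The canonical topology of [dual] is the norm topology; the alias
   [weak_star] carries the topology of pointwise convergence on [X]. *)
Definition weak_star : Type :=
  initial_topology (fun f : dual => (f : {ptws X -> R^o})).

HB.instance Definition _ := Topological.on weak_star.

(* [x] is a total function on finite sequences, but only its values on the
   sequences of length at most [n] matter. *)
Definition weak_star_null (n : nat) (x : seq nat -> dual) : Prop :=
  forall t : seq nat, (size t < n)%N ->
    (fun k => x (rcons t k) : weak_star) @ \oo --> ((0 : dual) : weak_star).

Definition property_star : Prop :=
  exists2 e : R, 0 < e & forall n, (1 <= n)%N ->
    exists x : seq nat -> dual,
      [/\ weak_star_null n x,
          `|x [::]| <= 1,
          forall s, s != [::] -> (size s <= n)%N -> e <= `|x s| &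
          forall (s : seq nat) (eps : 'I_n -> R), size s = n ->
            (forall i, eps i \in [:: -1; 1]) ->
            `|x [::] + \sum_(i < n) eps i *: x (take i.+1 s)| <= 1].

Definition finite_codimension (Y : set dual) : Prop :=
  exists k (v : 'I_k -> dual), forall f : dual,
    exists a : 'I_k -> R, Y (f - \sum_(i < k) a i *: v i).

Definition cof_weak_star : set (set dual) :=
  [set Y : set dual | [/\ submod_closed (mem Y), closed (Y : set weak_star)
             & finite_codimension Y]].

(* [subspace_game n P] is
     forall X_1 in cof, exists x_1 in S_(X_1), ...,
     forall X_n in cof, exists x_n in S_(X_n), P [:: x_1; ...; x_n] *)
Fixpoint subspace_game (n : nat) (P : seq dual -> Prop) : Prop :=
  if n is m.+1 then
    forall Y, cof_weak_star Y -> exists y : dual,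
      [/\ Y y, `|y| = 1 & subspace_game m (fun s => P (y :: s))]
  else P [::].

End Dual.

Definition equivalent_families {R : realType} (V W : normedModType R)
    (n : nat) (C : R) (x : 'I_n -> V) (e : 'I_n -> W) : Prop :=
  exists A B : R, [/\ 0 < A, 0 < B, A * B <= C &
    forall a : 'I_n -> R,
      A^-1 * `|\sum_(i < n) a i *: e i| <= `|\sum_(i < n) a i *: x i| /\
      `|\sum_(i < n) a i *: x i| <= B * `|\sum_(i < n) a i *: e i|].

Definition normalized_basis {R : realType} (E : normedModType R) (n : nat)
    (e : 'I_n -> E) : Prop :=
  (forall i, `|e i| = 1) /\
  (forall v : E, exists! a : 'I_n -> R, v = \sum_(i < n) a i *: e i).

Definition weak_star_asymptotic_structure {R : realType}
    (X : normedModType R) (n : nat) (E : normedModType R) (e : 'I_n -> E) :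
    Prop :=
  normalized_basis e /\
  forall eps : R, 0 < eps ->
    subspace_game (X := X) n (fun s =>
      equivalent_families (1 + eps) (fun i : 'I_n => s`_i) e).

(* Main.v *)
Require Import Defs.
From mathcomp Require Import all_boot all_order all_algebra.
From mathcomp Require Import all_classical all_reals all_analysis.
From mathcomp Require Import ring lra.
Import Order.TTheory GRing.Theory Num.Theory numFieldNormedType.Exports.
Local Open Scope classical_set_scope.
Local Open Scope ring_scope.
Set Implicit Arguments.
Unset Strict Implicit.
Unset Printing Implicit Defensive.

(** The argument is the finite-dimensional James blocking argument for
    [l_infty], played inside the subspace game.

    Write [zonotope s] for the set of all sums of [a_i *: s_i] with
    coefficients in [-1, 1].  If [s] consists of unit vectors and its zonotope
    lies in the ball of radius [rho < 2], then [s] is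
    [rho / (2 - rho)]-equivalent to the basis of [l_infty^n]: flipping the sign
    of the largest coefficient turns the upper estimate into a lower one
    ([zonotope_equivalent]).  So it suffices to reach, in the game, normalized
    vectors whose zonotope lies in a ball of radius close to 1.

    A weak-star closed subspace of finite codimension contains the annihilator
    of a finite subset of [X] ([cof_weak_star_annihilator]), so the opponent may
    be assumed to play finite lists of points, and two moves are played at once
    by concatenating the lists.  A weak-star null sequence comes close in norm
    to any such annihilator ([annihilator_approximation]); following a branch
    of the tree given by property (star) therefore produces, in games of every
    length, vectors of norm at least a fixed [c > 0] with zonotope in the unit
    ball ([property_star_game]).

    Finally [c] can be pushed to any [r < 1] ([zonotope_game_amplify]).  Let
    [c] range over the constants that can be reached in games of every length.
    Suppose that, at some length [N], norms at least [c] cannot be had together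
    with a zonotope in the ball of radius [r].  In a game of length [n * N] won
    with constant [c], let the opponent use, in each of the [n] blocks, a play
    that defeats the smaller radius: each block then has an element of its
    zonotope of norm greater than [r], and these [n] elements still have their
    zonotope in the unit ball ([annihilator_game_blocks]).  So if the constant
    [r] is out of reach, the radius [r] is reached along with [c] at every
    length; rescaling, [c / r] is as good as [c], which is absurd for [c]
    close to the supremum of the constants, since that supremum is at
    most 1. *)

(** * Annihilators of finite sets and weak-star closed subspaces *)

Section Annihilators.
Context {R : realType} {X : normedModType R}.
Implicit Types (f g v : dual X) (xs : seq X) (Y : set (dual X)).

Lemma dualD f g x : (f + g) x = f x + g x. Proof. by []. Qed.

Lemma dualN f x : (- f) x = - f x. Proof. by []. Qed.

Lemma dualZ (a : R) f x : (a *: f) x = a * f x. Proof. by []. Qed.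

Lemma dual_affine f (a : R) x y : f (x + a *: y) = f x + a * f y.
Proof. by rewrite addrC dual_linear addrC. Qed.

Lemma dual0 f : f 0 = 0.
Proof.
by have := dual_affine f (-1) 0 0; rewrite scaleN1r subr0 mulN1r subrr.
Qed.

Lemma dual_scale f (a : R) x : f (a *: x) = a * f x.
Proof. by rewrite -[a *: x]add0r dual_affine dual0 add0r. Qed.

Lemma dual_le f x : `|f x| <= `|f| * `|x|.
Proof.
have [->|x0] := eqVneq x 0.
  by rewrite normr0 mulr0 dual0 normr0.
rewrite -ler_pdivrMr ?normr_gt0//.
rewrite -[X in _ / X]normr_id -normf_div mulrC -dual_scale dual_norm_ub//.
by rewrite normrZ normfV normr_id mulVf// normr_eq0.
Qed.

Definition annihilator xs : set (dual X) :=
  [set f | forall x, x \in xs -> f x = 0].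

Definition linear_subspace Y :=
  Y 0 /\ forall (a : R) f g, Y f -> Y g -> Y (f + a *: g).

Lemma annihilator_cons x xs f :
  f x = 0 -> annihilator xs f -> annihilator (x :: xs) f.
Proof. by move=> fx fxs y; rewrite inE => /predU1P[->//|/fxs]. Qed.

Lemma annihilator_linear xs : linear_subspace (annihilator xs).
Proof.
split=> [//|a f g fxs gxs x xxs].
by rewrite dualD dualZ fxs// gxs// mulr0 addr0.
Qed.

Lemma weak_star_cvg_eval (u : nat -> dual X) :
  (fun k => u k : weak_star X) @ \oo --> ((0 : dual X) : weak_star X) ->
  forall x, (fun k => u k x : R) @ \oo --> (0 : R).
Proof.
move=> u0 x.
have c0 := @initial_continuous (dual X) {ptws X -> R^o}
   (fun f : dual X => (f : {ptws X -> R^o})) (0 : dual X).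
have c1 := @proj_continuous X (fun=> R^o) x ((0 : dual X) : X -> R^o).
exact: (cvg_comp _ _ u0 (cvg_comp _ _ c0 c1)).
Qed.

(** The sets of forms that agree with [v] on a finite set generate a filter that
    converges pointwise to [v]. *)
Lemma weak_star_closed_agree Y v : closed (Y : set (weak_star X)) ->
  (forall xs, exists2 y, Y y & forall x, x \in xs -> y x = v x) -> Y v.
Proof.
move=> clY appr.
pose B xs : set (weak_star X) :=
  [set y : dual X | forall x, x \in xs -> y x = v x].
pose F : set_system (weak_star X) := filter_from setT B.
have FF : Filter F.
  apply: filter_from_filter; first by exists [::].
  move=> xs ys _ _; exists (xs ++ ys) => // y /= yxs.
  by split=> x xxs; apply: yxs; rewrite mem_cat xxs ?orbT.
have Fv : F --> (v : weak_star X).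
  have : {ptws, (fun f : dual X => f : X -> R^o) @ F --> (v : X -> R^o)}.
    apply/pointwise_cvgP => x U Uv; exists [:: x] => // f /= fv.
    by rewrite /= fv ?mem_head//; exact: nbhs_singleton Uv.
  move=> cv U /= [_ [[W oW <-] Wv sWU]].
  apply: (filterS sWU); apply: (cv W); exact: open_nbhs_nbhs.
apply: clY => U /Fv[xs _ BU].
by have [y Yy yxs] := appr xs; exists y; split=> //; exact: BU.
Qed.

(** A vector outside a subspace of a finite-dimensional space is separated from
    it by a functional; here the finite-dimensional space is the space of
    values on [xs], whose functionals are the combinations of [xs].  In the
    induction the value at the first point is removed by means of a form [y1]
    of [Y] with [y1 x = 1], if there is one. *)
Lemma subspace_separation xs Y v : linear_subspace Y ->
  (forall y, Y y -> ~ (forall x, x \in xs -> y x = v x)) ->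
  exists2 x, (forall y, Y y -> y x = 0) & v x = 1.
Proof.
elim: xs Y v => [|x xs IH] Y v [Y0 Ylin] Yv; first by case: (Yv 0 Y0).
have [[y1 [Yy1 y11]]|no] := pselect (exists y, Y y /\ y x = 1).
  have [||z zY zv] := IH [set y | Y y /\ y x = 0] (v - v x *: y1).
  - split=> [//|a f g [Yf fx] [Yg gx]]; split; first exact: Ylin.
    by rewrite dualD dualZ fx gx mulr0 addr0.
  - move=> y [Yy yx] yv; apply: (Yv (y + v x *: y1)); first exact: Ylin.
    move=> z; rewrite inE dualD dualZ => /predU1P[->|zxs].
      by rewrite yx y11 mulr1 add0r.
    by rewrite yv// dualD dualN dualZ subrK.
  exists (z + (- y1 z) *: x) => [y Yy|].
    rewrite dual_affine.
    have : (y - y x *: y1) z = 0.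
      apply: zY; split; first by rewrite -scaleNr; exact: Ylin.
      by rewrite dualD dualN dualZ y11 mulr1 subrr.
    by rewrite dualD dualN dualZ mulNr mulrC.
  rewrite dual_affine mulNr mulrC.
  by move: zv; rewrite dualD dualN dualZ.
have Yx y : Y y -> y x = 0.
  move=> Yy; have [//|yx0] := eqVneq (y x) 0.
  exfalso; apply: no; exists (0 + (y x)^-1 *: y); split; first exact: Ylin.
  by rewrite add0r dualZ mulVf.
have [vx0|vx0] := eqVneq (v x) 0.
  apply: IH => // y Yy yv; apply: (Yv y Yy) => z; rewrite inE.
  by case/predU1P=> [->|/yv//]; rewrite vx0 Yx.
exists ((v x)^-1 *: x) => [y Yy|]; rewrite dual_scale ?mulVf//.
by rewrite (Yx y)// mulr0.
Qed.

(** Equivalently, [Y] is the annihilator of its pre-annihilator in [X]. *)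
Definition predual_separated Y :=
  forall v, ~ Y v -> exists2 x, (forall y, Y y -> y x = 0) & v x = 1.

Lemma weak_star_closed_separated Y :
  linear_subspace Y -> closed (Y : set (weak_star X)) -> predual_separated Y.
Proof.
move=> sY clY v Yv.
have [xs agr] : exists xs, forall y, Y y -> ~ (forall x, x \in xs -> y x = v x).
  apply: contrapT => no; apply/Yv/(weak_star_closed_agree clY) => xs.
  apply: contrapT => no'; apply: no; exists xs => y Yy yv; apply: no'.
  by exists y.
exact: subspace_separation agr.
Qed.

(** Induction on the codimension.  If a point [x0] kills [Y] but not the first
    vector [v] of a complement, then [Y + R v] is again separated, and [Y] is
    its intersection with the kernel of the evaluation at [x0]. *)
Lemma separated_finite_codimension Y k (w : 'I_k -> dual X) :
  linear_subspace Y -> predual_separated Y ->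
  (forall f, exists a : 'I_k -> R, Y (f - \sum_(i < k) a i *: w i)) ->
  exists xs, annihilator xs `<=` Y.
Proof.
elim: k Y w => [|k IH] Y w [Y0 Ylin] sepY cod.
  by exists [::] => f _; have [a] := cod f; rewrite big_ord0 subr0.
have [Yv|nYv] := pselect (Y (w ord0)).
  apply: (IH Y (fun i => w (lift ord0 i))) => // f.
  have [a Ya] := cod f; exists (fun i => a (lift ord0 i)).
  move: (Ylin (a ord0) _ _ Ya Yv).
  by rewrite big_ord_recl [X in _ - X]addrC opprD addrA subrK.
have [x0 x0Y x0v] := sepY _ nYv.
pose Z := [set f | exists a : R, Y (f + a *: w ord0)].
have Zv f : Z f -> Y (f - f x0 *: w ord0).
  move=> [a Ya]; suff -> : - (f x0 *: w ord0) = a *: w ord0 by [].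
  have := x0Y _ Ya; rewrite dualD dualZ x0v mulr1 => /eqP.
  by rewrite addr_eq0 => /eqP ->; rewrite scaleNr opprK.
have [||f|xs xsZ] := IH Z (fun i => w (lift ord0 i)).
- split; first by exists 0; rewrite scale0r addr0.
  move=> a f g [b Yb] [c Yc]; exists (b + a * c).
  by rewrite scalerDl -scalerA addrACA -scalerDr; exact: Ylin.
- move=> f Zf.
  have [|x' x'Y x'f] := sepY (f - f x0 *: w ord0).
    by move=> Yf; apply: Zf; exists (- f x0); rewrite scaleNr.
  exists (x' + (- w ord0 x') *: x0).
    move=> y [a Ya]; rewrite dual_affine.
    have := x'Y _ Ya; have := x0Y _ Ya; rewrite !dualD !dualZ x0v mulr1.
    by move/eqP; rewrite addr_eq0 => /eqP ->; rewrite mulrNN mulrC.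
  by move: x'f; rewrite dual_affine dualD dualN dualZ mulNr mulrC.
- have [a Ya] := cod f; exists (fun i => a (lift ord0 i)), (- a ord0).
  by move: Ya; rewrite big_ord_recl opprD addrA scaleNr addrAC.
exists (x0 :: xs) => f fxs.
have /Zv : Z f by apply: xsZ => x xxs; apply: fxs; rewrite inE xxs orbT.
by rewrite fxs ?mem_head// scale0r subr0.
Qed.

Lemma cof_weak_star_annihilator Y :
  cof_weak_star Y -> exists xs, annihilator xs `<=` Y.
Proof.
move=> [[Y0 Ylin] clY [k [w cod]]].
have sY : linear_subspace Y.
  split=> [|a f g Yf Yg]; first exact/set_mem.
  rewrite addrC; apply/set_mem.
  exact: (Ylin a g f (mem_set Yg) (mem_set Yf)).
apply: separated_finite_codimension cod => //.
exact: weak_star_closed_separated.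
Qed.

(** One point [x] is added at a time: subtracting the multiple [w k x *: g] of a
    form [g] with [g x = 1] costs [`|w k x|], which tends to 0 because both
    [u k x] and the norm of [u k - w k] do. *)
Lemma annihilator_approximation xs (u : nat -> dual X) :
  (forall x, (fun k => u k x : R) @ \oo --> (0 : R)) ->
  exists2 w : nat -> dual X, (forall k, annihilator xs (w k)) &
    (fun k => u k - w k) @ \oo --> (0 : dual X).
Proof.
move=> u0; elim: xs => [|x xs [w wxs uw]].
  exists u => //; under eq_fun do rewrite subrr; exact: cvg_cst.
have [[g [gxs gx]]|no] := pselect (exists g, annihilator xs g /\ g x = 1).
  have [_ alin] := annihilator_linear xs.
  exists (fun k => w k - w k x *: g) => [k|].
    apply: annihilator_cons; last by rewrite -scaleNr; exact: alin.
    by rewrite dualD dualN dualZ gx mulr1 subrr.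
  have wx : (fun k => w k x : R) @ \oo --> (0 : R).
    have -> : (fun k => w k x : R) = (fun k => u k x - (u k - w k) x).
      by apply/funext => k; rewrite dualD dualN opprB addrC subrK.
    rewrite -[0 in X in _ --> X](subrr (0 : R)); apply: cvgB; first exact: u0.
    apply: norm_cvg0.
    apply: (@squeeze_cvgr _ _ _ _ (cst 0) (fun k => `|u k - w k| * `|x|)).
    - by near=> k; rewrite normr_ge0 dual_le.
    - exact: cvg_cst.
    - rewrite -[0 in X in _ --> X](mul0r `|x|); apply: cvgMr_tmp.
      by rewrite -(normr0 (dual X)); exact: cvg_norm.
  have -> : (fun k => u k - (w k - w k x *: g)) =
            (fun k => (u k - w k) + w k x *: g).
    by apply/funext => k; rewrite opprB addrCA addrC.
  have := cvgD uw (cvgZr_tmp (a := g) wx); rewrite scale0r addr0; exact.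
exists w => // k; apply: annihilator_cons => //.
have [//|wx0] := eqVneq (w k x) 0.
exfalso; apply: no; exists ((w k x)^-1 *: w k); split.
  by rewrite -[_ *: _]add0r; apply: (annihilator_linear xs).2.
by rewrite dualZ mulVf.
Unshelve. all: by end_near. Qed.

End Annihilators.

(** * Sums with coefficients in [-1, 1] *)

Section Zonotopes.
Context {R : realType} {V : normedModType R}.
Implicit Types (s : seq V) (w y z : V) (a : R).

Fixpoint zonotope s : set V :=
  if s is y :: s' then
    [set z | exists a z', [/\ `|a| <= 1, zonotope s' z' & z = a *: y + z']]
  else [set 0].

Lemma zonotope_scale s z a : `|a| <= 1 -> zonotope s z -> zonotope s (a *: z).
Proof.
move=> a1; elim: s z => [|y s IH] z /=; first by move=> ->; rewrite scaler0.
move=> [b [z' [b1 sz' ->]]]; exists (a * b), (a *: z'); split.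
- by rewrite normrM mulr_ile1.
- exact: IH.
- by rewrite scalerDr scalerA.
Qed.

Lemma zonotope_cat s1 s2 z1 z2 :
  zonotope s1 z1 -> zonotope s2 z2 -> zonotope (s1 ++ s2) (z1 + z2).
Proof.
elim: s1 z1 => [|y s1 IH] z1 /=; first by move=> ->; rewrite add0r.
move=> [a [z' [a1 sz' ->]]] sz2; exists a, (z' + z2).
by split; [|exact: IH|rewrite addrA].
Qed.

Lemma zonotope_sum s (a : nat -> R) :
  (forall i, (i < size s)%N -> `|a i| <= 1) ->
  zonotope s (\sum_(i < size s) a i *: s`_i).
Proof.
elim: s a => [|y s IH] a a1; first by rewrite big_ord0.
rewrite [size _]/= big_ord_recl; exists (a 0%N).
exists (\sum_(i < size s) a i.+1 *: s`_i); split=> //; first exact: (a1 0%N).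
by apply: (IH (fun i => a i.+1)) => i si; exact: (a1 i.+1).
Qed.

Lemma zonotope_rescale (g : V -> R) (k : R) s z : 0 < k ->
  (forall y, y \in s -> `|g y| <= k) ->
  zonotope [seq g y *: y | y <- s] z -> zonotope s (k^-1 *: z).
Proof.
move=> k0; elim: s z => [|y s IH] z /= gk; first by move=> ->; rewrite scaler0.
move=> [a [z' [a1 sz' ->]]]; exists (k^-1 * (a * g y)), (k^-1 *: z'); split.
- rewrite normrM normfV (gtr0_norm k0) ler_pdivrMl// mulr1 normrM.
  by rewrite (le_trans (ler_piMl _ a1))// gk// mem_head.
- by apply: IH => // x xs; apply: gk; rewrite inE xs orbT.
- by rewrite scalerDr !scalerA.
Qed.

Lemma convex_norm_le w y a (r : R) : `|a| <= 1 ->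
  `|w + y| <= r -> `|w - y| <= r -> `|w + a *: y| <= r.
Proof.
rewrite ler_norml => /andP[a1 a2] wp wm.
have -> : w + a *: y = ((1 + a) / 2) *: (w + y) + ((1 - a) / 2) *: (w - y).
  rewrite !scalerDr !scalerN addrACA -scalerDl -scalerBl.
  have -> : (1 + a) / 2 + (1 - a) / 2 = 1 :> R by field.
  have -> : (1 + a) / 2 - (1 - a) / 2 = a :> R by field.
  by rewrite scale1r.
rewrite (le_trans (ler_normD _ _))//.
have p1 : 0 <= (1 + a) / 2 by lra.
have p2 : 0 <= (1 - a) / 2 by lra.
rewrite normrZ (ger0_norm p1) normrZ (ger0_norm p2).
have := ler_wpM2l p1 wp; have := ler_wpM2l p2 wm; lra.
Qed.

(** The norm is convex, so its maximum over the cube of coefficients is reached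
    at a vertex. *)
Lemma zonotope_sign_le s w (r : R) :
  (forall eps : nat -> R, (forall i, eps i \in [:: -1; 1]) ->
     `|w + \sum_(i < size s) eps i *: s`_i| <= r) ->
  forall z, zonotope s z -> `|w + z| <= r.
Proof.
elim: s w => [|y s IH] w wr z /=.
  move=> ->; have := wr (fun=> 1); rewrite big_ord0; apply => i.
  by rewrite !inE eqxx orbT.
move=> [a [z' [a1 sz' ->]]]; rewrite addrA addrAC.
have wb (b : R) : b \in [:: -1; 1] -> `|(w + z') + b *: y| <= r.
  move=> b1; rewrite addrAC; apply: IH => // eps eps1.
  have := wr (fun i => if i is j.+1 then eps j else b).
  by rewrite [size _]/= big_ord_recl /= addrA; apply => -[].
apply: convex_norm_le => //.
- by have := wb 1; rewrite scale1r; apply; rewrite !inE eqxx orbT.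
- by have := wb (-1); rewrite scaleN1r; apply; rewrite !inE eqxx.
Qed.

End Zonotopes.


(** * The game on finite sets of points and the blocking argument *)

Section Game.
Context {R : realType} {X : normedModType R}.
Implicit Types (xs : seq X) (A Q : set (dual X)) (s : seq (dual X)).
Implicit Types (P U : seq (dual X) -> Prop) (m n N : nat) (c r t : R).

(** The subspace game with annihilators of finite lists as the opponent's moves,
    [Q] being required of each reply and [P] of the sequence of replies. *)
Fixpoint annihilator_game n Q P : Prop :=
  if n is m.+1 then
    forall xs, exists y, [/\ annihilator xs y, Q y &
      annihilator_game m Q (fun s => P (y :: s))]
  else P [::].

(** Annihilators are stable under scaling, so replies may be rescaled, each by a
    factor of its own. *)
Lemma annihilator_game_rescale (g : dual X -> R) n Q Q' P P' :
  (forall y, Q y -> Q' (g y *: y)) ->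
  (forall s, size s = n -> (forall y, y \in s -> Q y) -> P s ->
     P' [seq g y *: y | y <- s]) ->
  annihilator_game n Q P -> annihilator_game n Q' P'.
Proof.
move=> QQ'; elim: n P P' => [|n IH] P P' PP' /=; first exact: (PP' [::]).
move=> G xs; have [y [yxs Qy Gy]] := G xs; exists (g y *: y); split.
- by rewrite -[_ *: y]add0r; apply: (annihilator_linear xs).2.
- exact: QQ'.
- apply: IH Gy => s sn sQ Ps; apply: (PP' (y :: s)) => //=; first by rewrite sn.
  by move=> z; rewrite inE => /predU1P[->|/sQ].
Qed.

Lemma annihilator_game_imply n Q P P' : (forall s, P s -> P' s) ->
  annihilator_game n Q P -> annihilator_game n Q P'.
Proof.
move=> PP'; apply: (annihilator_game_rescale (g := fun=> 1)) => [y|s _ _ /PP'].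
  by rewrite scale1r.
by under eq_map do rewrite scale1r; rewrite map_id.
Qed.

Lemma annihilator_game_split N n Q P : annihilator_game (N + n) Q P ->
  annihilator_game N Q (fun s => annihilator_game n Q (fun s' => P (s ++ s'))).
Proof.
elim: N P => [//|N IH] P /= G xs; have [y [yxs Qy Gy]] := G xs.
by exists y; split=> //; exact: (IH (fun s => P (y :: s))).
Qed.

(** Winning for [P] but not for [U] yields a single play that meets [P] and
    violates [U]: the winning replies for [P] are played against moves that
    defeat [U], to which [xs] is adjoined. *)
Lemma annihilator_game_clash N Q P U xs :
  annihilator_game N Q P -> ~ annihilator_game N Q U ->
  exists s, [/\ forall y, y \in s -> annihilator xs y, P s & ~ U s].
Proof.
elim: N P U => [|N IH] P U /=; first by exists [::].
move=> GP /existsNP[ys noU].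
have [y [yxs Qy Gy]] := GP (xs ++ ys).
have [s [sxs Ps Us]] : exists s, [/\ forall y, y \in s -> annihilator xs y,
    P (y :: s) & ~ U (y :: s)].
  apply: IH (Gy) _ => GU; apply: noU; exists y; split=> // x xys.
  by apply: yxs; rewrite mem_cat xys orbT.
exists (y :: s); split=> // z; rewrite inE => /predU1P[->|/sxs//] x xxs.
by apply: yxs; rewrite mem_cat xxs.
Qed.

Lemma zonotope_annihilator xs s z :
  (forall y, y \in s -> annihilator xs y) -> zonotope s z -> annihilator xs z.
Proof.
elim: s z => [|y s IH] z sxs /=; first by move=> ->.
move=> [a [z' [_ sz' ->]]]; rewrite addrC.
apply: (annihilator_linear xs).2; last exact/sxs/mem_head.
by apply: IH sz' => x xs'; apply: sxs; rewrite inE xs' orbT.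
Qed.

Definition translates_in_ball A s :=
  forall w z, A w -> zonotope s z -> `|w + z| <= 1.

(** Each block of [N] moves is condensed into one element [z] of norm greater
    than [r] of its zonotope.  The set [A] holds what the preceding blocks can
    contribute to a sum; it grows from [A] to [A + [-1, 1] z]. *)
Lemma annihilator_game_blocks N n Q r A :
  ~ annihilator_game N Q (fun s => forall z, zonotope s z -> `|z| <= r) ->
  annihilator_game (n * N) Q (translates_in_ball A) ->
  annihilator_game n [set z | r < `|z|] (translates_in_ball A).
Proof.
move=> noN; elim: n A => [//|n IH] A; rewrite mulSn => G xs.
have [s [sxs Gs /existsNP[z /not_implyP[sz /negP]]]] :=
  annihilator_game_clash xs (annihilator_game_split G) noN.
rewrite -ltNge => rz; exists z; split=> //.
  exact: zonotope_annihilator sz.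
pose A' := [set w | exists w' a, [/\ A w', `|a| <= 1 & w = w' + a *: z]].
have /IH : annihilator_game (n * N) Q (translates_in_ball A').
  apply: annihilator_game_imply Gs => s' s'1 _ z' [w [a [Aw a1 ->]]] sz'.
  by rewrite -addrA s'1//; apply: zonotope_cat => //; exact: zonotope_scale.
apply: annihilator_game_imply => s' s'1 w _ Aw [a [z' [a1 sz' ->]]].
by rewrite addrA s'1//; exists w, a.
Qed.

Definition zonotope_game n c r : Prop :=
  annihilator_game n [set y | c <= `|y|]
    (fun s => forall z, zonotope s z -> `|z| <= r).

Lemma zonotope_game_rescale n c r t : 0 < t ->
  zonotope_game n c r -> zonotope_game n (t * c) (t * r).
Proof.
move=> t0.
apply: (annihilator_game_rescale (g := fun=> t)) => [y /= cy|s _ _ sr z].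
  by rewrite normrZ gtr0_norm// ler_pM2l.
have gt y : y \in s -> `|t| <= t by rewrite gtr0_norm.
move=> /(zonotope_rescale t0 gt)/sr.
by rewrite normrZ normfV gtr0_norm// ler_pdivrMl.
Qed.

(** If [r] cannot be reached, [boost] multiplies by [r^-1] any constant that is
    reached at every length; but the supremum of these constants lies between
    [c > 0] and 1. *)
Lemma zonotope_game_amplify c r n : 0 < c -> 0 < r < 1 ->
  (forall N, zonotope_game N c 1) ->
  annihilator_game n [set z | r < `|z|]
    (fun s => forall z, zonotope s z -> `|z| <= 1).
Proof.
move=> c0 /andP[r0 r1] Gc; apply: contrapT => noG.
have boost d : (forall N, zonotope_game N d 1) ->
    forall N, zonotope_game N (r^-1 * d) 1.
  move=> Gd N; rewrite -(mulVf (lt0r_neq0 r0)); apply: zonotope_game_rescale.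
    by rewrite invr_gt0.
  apply: contrapT => noN; apply: noG.
  have : annihilator_game (n * N) [set y | d <= `|y|]
      (translates_in_ball [set 0]).
    by apply: annihilator_game_imply (Gd _) => s s1 _ z -> sz; rewrite add0r s1.
  move/(annihilator_game_blocks noN).
  apply: annihilator_game_imply => s s1 z sz.
  by rewrite -[z]add0r; exact: s1.
pose S := [set d | forall N, zonotope_game N d 1].
have ubS : ubound S 1.
  move=> d /(_ 1%N [::])[y [_ /= dy y1]]; rewrite (le_trans dy)//.
  by apply: y1; exists 1, 0; rewrite normr1 scale1r addr0.
have supS : has_sup S by split; [exists c|exists 1].
have cS : c <= sup S by apply: ub_le_sup => //; exists 1.
have : sup S <= r * sup S.
  apply: ge_sup; first by exists c.
  move=> d /boost Sd; rewrite -ler_pdivrMl//; apply: ub_le_sup => //.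
  by exists 1.
have : 0 < sup S by exact: lt_le_trans cS.
nra.
Qed.

End Game.

(** * Playing along the branches of a weak-star null tree *)

Section Trees.
Context {R : realType} {X : normedModType R}.
Variable x : seq nat -> dual X.
Implicit Types (t u : seq nat) (s : seq (dual X)).

Fixpoint branch t u : seq (dual X) :=
  if u is k :: u' then x (rcons t k) :: branch (rcons t k) u' else [::].

Lemma size_branch t u : size (branch t u) = size u.
Proof. by elim: u t => //= k u IH t; rewrite IH. Qed.

Lemma nth_branch t u i : (i < size u)%N ->
  (branch t u)`_i = x (t ++ take i.+1 u).
Proof.
elim: u t i => [//|k u IH] t [|i] /= iu; first by rewrite take0 cats1.
by rewrite IH// cat_rcons.
Qed.

(** The nodes [x (rcons t k)] are weak-star null in [k], so whichever annihilator
    must be played in, one of them lies within [d] of it; the game goes on below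
    that node. *)
Lemma weak_star_null_game (N : nat) (e d : R) m t P : 0 < d ->
  weak_star_null N x ->
  (forall u, u != [::] -> (size u <= N)%N -> e <= `|x u|) ->
  (size t + m <= N)%N ->
  (forall s u, size s = m -> size u = m ->
     (forall i, `|s`_i - (branch t u)`_i| <= d) -> P s) ->
  annihilator_game m [set y | e - d <= `|y|] P.
Proof.
move=> d0 xnull xe; elim: m t P => [|m IH] t P tm nearP /=.
  by apply: (nearP [::] [::]) => // i; rewrite nth_nil subrr normr0 ltW.
move=> xs.
have tN : (size t < N)%N by rewrite (leq_trans _ tm)// addnS ltnS leq_addr.
have [w wxs xw] :=
  annihilator_approximation xs (weak_star_cvg_eval (xnull t tN)).
have [k /= xwk] : exists k, `|x (rcons t k) - w k| <= d.
  have [k _ /(_ k (leqnn k)) kd] := (cvgr0Pnorm_le _).1 xw _ d0.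
  by exists k.
exists (w k); split=> //=.
  have := xe (rcons t k); rewrite size_rcons => /(_ _ tN).
  have -> : rcons t k != [::] by case: (t).
  move=> /(_ isT); have := lerB_dist (x (rcons t k)) (w k).
  lra.
apply: (IH (rcons t k)); first by rewrite size_rcons addSnnS.
move=> s u sm um su; apply: (nearP (w k :: s) (k :: u)); rewrite /= ?sm ?um//.
by case=> [|i] /=; [rewrite distrC|exact: su].
Qed.

End Trees.

Section Approximation.
Context {R : realType} {V : normedModType R}.

Lemma zonotope_near (s s' : seq V) (d : R) z : size s = size s' ->
  (forall i, `|s`_i - s'`_i| <= d) -> zonotope s z ->
  exists2 z', zonotope s' z' & `|z - z'| <= (size s)%:R * d.
Proof.
elim: s s' z => [|y s IH] [|y' s']//= z.
  by move=> _ _ ->; exists 0; rewrite // subrr normr0 mul0r.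
move=> [ss'] near_ss' [a [w [a1 sw ->]]].
have [w' sw' ww'] := IH s' w ss' (fun i => near_ss' i.+1) sw.
exists (a *: y' + w'); first by exists a, w'.
rewrite opprD addrACA -scalerBr (le_trans (ler_normD _ _))//.
rewrite -natr1 mulrDl mul1r [leRHS]addrC lerD// normrZ.
by rewrite (le_trans (ler_piMl _ a1))//; exact: (near_ss' 0%N).
Qed.

End Approximation.

Section Conclusion.
Context {R : realType} {X : normedModType R}.

(** Along a branch, averaging [x_0 + z] and [-(x_0 - z)] removes the root from
    the estimate.  The errors [d] of the [N.+1] approximations add up to at most
    1, so the zonotope lies in the ball of radius 2, and halving the vectors
    brings it into the unit ball. *)
Lemma property_star_game : property_star X ->
  exists2 c : R, 0 < c & forall N, zonotope_game (X := X) N c 1.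
Proof.
move=> [e e0 treeX]; exists (2^-1 * (e / 2)); first by lra.
move=> [|N]; first by move=> z ->; rewrite normr0.
have [x [xnull _ xe x1]] := treeX N.+1 isT.
suff G2 : zonotope_game (X := X) N.+1 (e / 2) 2.
  rewrite -[X in zonotope_game _ _ X](@mulVf _ (2 : R)) ?pnatr_eq0//.
  by apply: zonotope_game_rescale; rewrite // invr_gt0 ltr0n.
(* [d <= e / 2] keeps the norms above [e / 2]. *)
pose d := Num.min (e / 2) (N.+1%:R^-1).
have d0 : 0 < d by rewrite lt_min divr_gt0//= invr_gt0 ltr0n.
have : annihilator_game (X := X) N.+1 [set y | e - d <= `|y|]
    (fun s => forall z, zonotope s z -> `|z| <= 2).
  apply: (@weak_star_null_game _ _ x N.+1 e d _ [::]) => // s u sN uN su z sz.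
  have [|z' uz' zz'] := zonotope_near _ su sz; first by rewrite size_branch sN.
  have branch1 w : zonotope (branch x [::] u) w -> `|x [::] + w| <= 1.
    apply: zonotope_sign_le => eps eps1; rewrite size_branch uN.
    rewrite (eq_bigr (fun i : 'I_N.+1 => eps i *: x (take i.+1 u))); last first.
      by move=> i _; rewrite nth_branch// uN.
    exact: (x1 u (fun i => eps i)).
  have z'1 : `|z'| <= 1.
    have w1 : `|-1 : R| <= 1 by rewrite normrN1.
    have := ler_normB (x [::] + z') (x [::] - z').
    have := branch1 _ (zonotope_scale w1 uz'); have := branch1 _ uz'.
    rewrite scaleN1r.
    have -> : x [::] + z' - (x [::] - z') = z' *+ 2.
      by rewrite opprB addrC addrA subrK.
    rewrite normrMn; move: `|z'| `|_ + z'| `|_ - z'| => p q r.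
    clear; lra.
  have Nd : (size s)%:R * d <= 1.
    by rewrite sN -ler_pdivlMl ?ltr0n// mulr1 ge_min lexx orbT.
  rewrite -[z](subrK z') (le_trans (ler_normD _ _))//; lra.
apply: (annihilator_game_rescale (g := fun=> 1)) => [y /=|s _ _ s2].
  rewrite scale1r; apply: le_trans.
  have : d <= e / 2 by rewrite ge_min lexx.
  lra.
by under eq_map do rewrite scale1r; rewrite map_id.
Qed.

Lemma subspace_game_annihilator n (P P' : seq (dual X) -> Prop) :
  (forall s, size s = n -> (forall y, y \in s -> `|y| = 1) -> P s -> P' s) ->
  annihilator_game n [set y | `|y| = 1] P -> subspace_game n P'.
Proof.
elim: n P P' => [|n IH] P P' PP' /=; first exact: (PP' [::]).
move=> G Y /cof_weak_star_annihilator[xs xsY].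
have [y [yxs y1 Gy]] := G xs; exists y; split=> //; first exact: xsY.
apply: IH Gy => s sn s1; apply: PP'; first by rewrite /= sn.
by move=> z; rewrite inE => /predU1P[->|/s1].
Qed.

End Conclusion.

(** * Equivalence with the unit vector basis of [l_infty^n] *)

Section SupNorm.
Context {R : realType}.

Lemma coord_le_norm n (v : 'rV[R]_n) i : `|v 0 i| <= `|v|.
Proof.
rewrite [leRHS]/Num.norm/= mx_normrE.
exact: (le_bigmax _ (fun ij : 'I_1 * 'I_n => `|v ij.1 ij.2|) (0, i)).
Qed.

Lemma norm_attained n (v : 'rV[R]_n) : `|v| != 0 -> exists i, `|v| = `|v 0 i|.
Proof. by move/mx_norm_neq0 => [[i j]]; rewrite ord1; exists j. Qed.

Lemma delta_comb n (a : 'I_n -> R) :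
  \sum_(i < n) a i *: (delta_mx 0 i : 'rV[R]_n) = \row_i a i.
Proof.
by rewrite [RHS]row_sum_delta; apply: eq_bigr => i _; rewrite mxE.
Qed.

Lemma delta_normalized_basis n :
  normalized_basis (fun i : 'I_n => delta_mx 0 i : 'rV[R]_n).
Proof.
split=> [i|v].
  have di : 1 <= `|delta_mx 0 i : 'rV[R]_n|.
    by apply: le_trans (coord_le_norm _ i); rewrite mxE !eqxx normr1.
  have [j nj] := norm_attained (lt0r_neq0 (lt_le_trans ltr01 di)).
  apply/eqP; rewrite eq_le di andbT nj mxE.
  by case: andP => _; rewrite ?normr1 ?normr0.
exists (v 0); split; first exact: row_sum_delta.
by move=> a ->; apply/funext => i; rewrite delta_comb mxE.
Qed.

(** For the lower estimate let [a_j] be a coefficient of maximal modulus [M].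
    Changing its sign changes the sum by [2 a_j s_j], of norm [2 M], while the
    changed sum has norm at most [rho M]. *)
Lemma zonotope_equivalent (V : normedModType R) n (rho : R) (s : seq V) :
  size s = n -> (forall y, y \in s -> `|y| = 1) -> 0 < rho < 2 ->
  (forall z, zonotope s z -> `|z| <= rho) ->
  equivalent_families (rho / (2 - rho)) (fun i : 'I_n => s`_i)
    (fun i => delta_mx 0 i : 'rV[R]_n).
Proof.
move=> sn s1 /andP[rho0 rho2] srho.
have upper (a : 'I_n -> R) M : 0 <= M -> (forall i, `|a i| <= M) ->
    `|\sum_(i < n) a i *: s`_i| <= rho * M.
  rewrite le_eqVlt => /predU1P[<- a0|M0 aM].
    rewrite big1 ?normr0 ?mulr0// => i _.
    by move: (a0 i); rewrite normr_le0 => /eqP ->; rewrite scale0r.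
  rewrite -ler_pdivrMr// -[X in _ / X]gtr0_norm// -normfV mulrC -normrZ.
  apply: srho; pose b k := M^-1 * oapp a 0 (insub k).
  have -> : M^-1 *: (\sum_(i < n) a i *: s`_i) = \sum_(i < size s) b i *: s`_i.
    by rewrite sn scaler_sumr; apply: eq_bigr => i _; rewrite scalerA /b valK.
  apply: zonotope_sum => i _; rewrite /b normrM normfV (gtr0_norm M0).
  rewrite ler_pdivrMl// mulr1.
  by case: insubP => [j _ _|_] /=; rewrite ?normr0// ltW.
exists (2 - rho)^-1, rho; split=> //; first by rewrite invr_gt0 subr_gt0.
  by rewrite mulrC.
move=> a; rewrite delta_comb invrK; set M := `|_|.
have aM i : `|a i| <= M by have := coord_le_norm (\row_i a i) i; rewrite mxE.
split; last by apply: upper => //; exact: normr_ge0.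
have [M0|M0] := eqVneq M 0; first by rewrite M0 mulr0.
have [j] := norm_attained M0; rewrite -/M mxE => Mj.
pose a' i := if i == j then - a j else a i.
have a'M i : `|a' i| <= M by rewrite /a'; case: eqP => _; rewrite ?normrN.
have := upper a' M (normr_ge0 _) a'M.
rewrite (bigD1 j)//= [in X in _ -> X](bigD1 j)//= {1}/a' eqxx.
rewrite (eq_bigr (fun i : 'I_n => a i *: s`_i)); last first.
  by move=> i /negPf ij; rewrite /a' ij.
set T := \sum_(i < n | _) _; rewrite scaleNr.
have := ler_normB (a j *: s`_j + T) (- (a j *: s`_j) + T).
rewrite opprD opprK addrACA subrr addr0 -mulr2n normrMn normrZ s1.
  by rewrite -Mj mulr1; lra.
by rewrite mem_nth// sn.
Qed.

End SupNorm.

Theorem mainTheorem5 (R : realType) (X : completeNormedModType R)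
    (sepX : separable X) (starX : property_star X) (n : nat) (n1 : (1 <= n)%N) :
  weak_star_asymptotic_structure X (fun i : 'I_n => delta_mx 0 i : 'rV[R]_n).
Proof.
split=> [|eps eps0]; first exact: delta_normalized_basis.
have [c c0 Gc] := property_star_game starX.
(* This [r] solves [r^-1 / (2 - r^-1) = 1 + eps]. *)
pose r : R := (2 + eps) / (2 + 2 * eps).
have r0 : 0 < r by rewrite divr_gt0//; lra.
have r1 : r < 1 by rewrite ltr_pdivrMr; lra.
have r01 : 0 < r < 1 by rewrite r0.
have : annihilator_game (X := X) n [set y | `|y| = 1]
    (fun s => forall z, zonotope s z -> `|z| <= r^-1).
  move: (zonotope_game_amplify n c0 r01 Gc).
  apply: (annihilator_game_rescale (g := fun z => `|z|^-1))
    => [y /= ry|s _ sr s1 z].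
    by rewrite normrZ normfV normr_id mulVf// gt_eqF// (lt_trans r0).
  have ri0 : 0 < r^-1 by rewrite invr_gt0.
  have sri y : y \in s -> `| `|y|^-1 | <= r^-1.
    move=> /sr /= ry; rewrite normfV normr_id lef_pV2 ?posrE ?ltW//.
    exact: lt_trans ry.
  move=> /(zonotope_rescale ri0 sri)/s1.
  by rewrite invrK normrZ gtr0_norm// -ler_pdivlMl// mulr1.
apply: subspace_game_annihilator => s sn s1 sr.
have -> : 1 + eps = r^-1 / (2 - r^-1) by rewrite /r; field; lra.
apply: zonotope_equivalent => //; rewrite invr_gt0 r0/=.
by rewrite invf_plt ?posrE// /r ltr_pdivlMr; lra.
Qed.
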